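(* Let $\delta t>0$ and, given $(\phi^n,\rho^n,U^n,V^n,W^n)$, let $(\phi^{n+1},\mu_\phi^{n+1},\rho^{n+1},\mu_\rho^{n+1},U^{n+1},V^{n+1},W^{n+1})$ satisfy, with periodic boundary conditions, the first order linear scheme $$\frac{\phi^{n+1}-\phi^n}{\delta t}=M_1\Delta\mu_\phi^{n+1},$$ $$\mu_\phi^{n+1}=-\epsilon\Delta\phi^{n+1}+\frac1\epsilon\phi^nU^{n+1}+\alpha\nabla\cdot(V^{n+1}\boldsymbol Z^n),$$ $$\frac{\rho^{n+1}-\rho^n}{\delta t}=M_2\Delta\mu_\rho^{n+1},$$ $$\mu_\rho^{n+1}=\alpha V^{n+1}+\beta H^nW^{n+1},$$ $$U^{n+1}-U^n=2\phi^n(\phi^{n+1}-\phi^n),$$ $$V^{n+1}-V^n=(\rho^{n+1}-\rho^n)-\boldsymbol Z^n\cdot\nabla(\phi^{n+1}-\phi^n),$$ $$W^{n+1}-W^n=\frac12H^n(\rho^{n+1}-\rho^n),$$ where $\boldsymbol Z^n=\boldsymbol Z(\phi^n)$ and $H^n=H(\rho^n)$. Then the scheme is unconditionally energy stable, i.e. for every time step size $\delta t>0$ the following discrete energy dissipation law holds: $$\frac1{\delta t}\big(E_{1st}^{n+1}-E_{1st}^n\big)\le-M_1\|\nabla\mu_\phi^{n+1}\|^2-M_2\|\nabla\mu_\rho^{n+1}\|^2,$$ where $$E_{1st}^n=\frac\epsilon2\|\nabla\phi^n\|^2+\frac1{4\epsilon}\|U^n\|^2+\frac\alpha2\|V^n\|^2+\beta\|W^n\|^2-\beta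 B.$$
   Context: $\Omega$ is a rectangular periodic box in $\mathbb R^d$, $d=2,3$ (e.g. $[0,2\pi]^d$); $(f,g)=\int_\Omega fg\,d\boldsymbol x$, $\|f\|=\sqrt{(f,f)}$. All functions are periodic on $\Omega$; $\phi^k,\mu_\phi^k,\mu_\rho^k\in H^1_{per}(\Omega)$ and $\rho^k,U^k,V^k,W^k\in L^2_{per}(\Omega)$, and the equations containing $\Delta$ or $\nabla\cdot$ are understood in the weak sense, tested against functions in $H^1_{per}(\Omega)$, integrating by parts with no boundary terms. The parameters $\epsilon,\alpha,\beta,M_1,M_2$ are positive constants. $\boldsymbol Z(\phi)=\nabla\phi/|\nabla\phi|$, with the convention $\boldsymbol Z(\phi)=0$ where $\nabla\phi=0$. $H(\rho)=\dfrac{g(\rho)}{\sqrt{G(\rho)+B}}$ with $g=G'$, where $G:\mathbb R\to\mathbb R$ is the regularized Flory–Huggins potential: for a fixed small $\widehat\epsilon\in(0,1/2)$, $$G(\rho)=\begin{cases}\rho\ln\rho+\frac{(1-\rho)^2}{2\widehat\epsilon}+(1-\rho)\ln\widehat\epsilon-\frac{\widehat\epsilon}{2},&\rho\ge1-\widehat\epsilon,\\ \rho\ln\rho+(1-\rho)\ln(1-\rho),&\widehat\epsilon\le\rho\le1-\widehat\epsilon,\\ (1-\rho)\ln(1-\rho)+\frac{\rho^2}{2\widehat\epsilon}+\rho\ln\widehat\epsilon-\frac{\widehat\epsilon}{2},&\rho\le\widehat\epsilon,\end{cases}$$ and $B>0$ is a constant such that $G(\rho)+B>0$ for all $\rho$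 (e.g. $B=1$). *)

(* Defs.v *)
From HB Require Import structures.
From mathcomp Require Import all_boot all_order all_algebra.
From mathcomp Require Import all_classical all_reals all_analysis.

Set Implicit Arguments.
Unset Strict Implicit.
Unset Printing Implicit Defensive.

Import Order.TTheory GRing.Theory Num.Theory.
Import numFieldNormedType.Exports.

Local Open Scope classical_set_scope.
Local Open Scope ring_scope.

(* MathComp-Analysis has no Lebesgue measure on R^n.  We equip ['rV[R]_n] with
   the sigma-algebra generated by the coordinates (the Borel sets) and obtain
   the measure by induction on [n] from the binary product measure.           *)

Definition rV_coord (R : realType) (n : nat) (i : 'I_n) (v : 'rV[R]_n) :
  measurableTypeR R := v ord0 i.

Definition rV_display : measure_display.
Proof. by constructor. Qed.

Section measurable_rV.
Variables (R : realType) (n : nat).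

Let rV_set0 : g_sigma_preimage (@rV_coord R n) set0.
Proof. exact: sigma_algebra0. Qed.

Let rV_setC A : g_sigma_preimage (@rV_coord R n) A ->
  g_sigma_preimage (@rV_coord R n) (~` A).
Proof. exact: sigma_algebraC. Qed.

Let rV_bigcup (F : (set 'rV[R]_n)^nat) :
  (forall i, g_sigma_preimage (@rV_coord R n) (F i)) ->
  g_sigma_preimage (@rV_coord R n) (\bigcup_i (F i)).
Proof. exact: sigma_algebra_bigcup. Qed.

HB.instance Definition _ := @isMeasurable.Build rV_display 'rV[R]_n
  (g_sigma_preimage (@rV_coord R n)) rV_set0 rV_setC rV_bigcup.

End measurable_rV.

Lemma measurable_rV_coord (R : realType) (n : nat) (i : 'I_n) :
  measurable_fun [set: 'rV[R]_n] (@rV_coord R n i).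
Proof.
move=> _ Y mY; rewrite setTI; apply: sub_sigma_algebra => /=.
rewrite -bigcup_seq/=; exists i => /=; first by rewrite mem_index_enum.
by exists Y => //; rewrite setTI.
Qed.

Lemma measurable_fun_rVP (d : measure_display) (T : measurableType d)
    (R : realType) (n : nat) (f : T -> 'rV[R]_n) :
  (forall i, measurable_fun [set: T] (@rV_coord R n i \o f)) ->
  measurable_fun [set: T] f.
Proof.
move=> mf; apply: (measurability
  (\big[setU/set0]_(i < n) preimage_set_system setT (@rV_coord R n i) measurable)).
  by [].
move=> _ [B + <-]; rewrite -bigcup_seq => -[i _ [C mC <-]].
by have := mf i measurableT C mC; rewrite comp_preimage !setTI.
Qed.

Definition rV_cons (R : realType) (n : nat)
    (p : measurableTypeR R * 'rV[R]_n) : 'rV[R]_n.+1 :=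
  row_mx (p.1%:M : 'rV[R]_1) p.2.

Lemma rV_consE (R : realType) (n : nat) (p : measurableTypeR R * 'rV[R]_n)
    (i : 'I_n.+1) :
  rV_cons p ord0 i = if unlift ord0 i is Some j then p.2 ord0 j else p.1.
Proof.
rewrite /rV_cons; case: unliftP => [j ->|->].
  by rewrite -rshift1 (row_mxEr (p.1%:M : 'rV[R]_1)).
have -> : ord0 = lshift n (ord0 : 'I_1) by exact: val_inj.
by rewrite (row_mxEl (p.1%:M : 'rV[R]_1)) mxE eqxx mulr1n.
Qed.

Lemma measurable_rV_cons (R : realType) (n : nat) :
  measurable_fun [set: measurableTypeR R * 'rV[R]_n] (@rV_cons R n).
Proof.
apply: measurable_fun_rVP => i.
have [j ij|i0] := unliftP ord0 i.
  rewrite (_ : _ \o _ = @rV_coord R n j \o snd).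
    by apply: measurableT_comp => //; exact: measurable_rV_coord.
  by apply/funext => p /=; rewrite /rV_coord rV_consE ij liftK.
rewrite (_ : _ \o _ = fst) //.
by apply/funext => p /=; rewrite /rV_coord rV_consE i0 unlift_none.
Qed.

Definition rV_uncons (R : realType) (n : nat) (v : 'rV[R]_n.+1) :
    measurableTypeR R * 'rV[R]_n :=
  (v ord0 ord0, \row_j v ord0 (lift ord0 j)).

Lemma rV_consK (R : realType) (n : nat) : cancel (@rV_cons R n) (@rV_uncons R n).
Proof.
case=> x v; rewrite /rV_uncons rV_consE unlift_none; congr (_, _).
by apply/rowP => j; rewrite mxE rV_consE liftK.
Qed.

Lemma measurable_rV_uncons (R : realType) (n : nat) :
  measurable_fun [set: 'rV[R]_n.+1] (@rV_uncons R n).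
Proof.
apply/measurable_fun_pairP; split; first exact: measurable_rV_coord.
apply: measurable_fun_rVP => j.
rewrite (_ : _ \o _ = @rV_coord R n.+1 (lift ord0 j)).
  exact: measurable_rV_coord.
by apply/funext => v /=; rewrite /rV_coord mxE.
Qed.

Section lebesgue_rV_step.
Variables (R : realType) (n : nat) (m : {sigma_finite_measure set 'rV[R]_n -> \bar R}).

Definition lebesgue_rV_step : set 'rV[R]_n.+1 -> \bar R :=
  pushforward (@lebesgue_measure R \x m)%E (@rV_cons R n).

Let step0 : lebesgue_rV_step set0 = 0%E.
Proof. by rewrite /lebesgue_rV_step /pushforward preimage_set0 measure0. Qed.

Let step_ge0 A : (0 <= lebesgue_rV_step A)%E.
Proof. exact: (measure_ge0 (@lebesgue_measure R \x m)%E). Qed.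

Let step_sigma_additive : semi_sigma_additive lebesgue_rV_step.
Proof.
exact: (@measure_semi_sigma_additive _ _ _
  (measure_function_pushforward__canonical__measure_function_Measure
    (@lebesgue_measure R \x m)%E (@measurable_rV_cons R n))).
Qed.

HB.instance Definition _ := isMeasure.Build _ _ _
  lebesgue_rV_step step0 step_ge0 step_sigma_additive.

Let step_sigma_finite : sigma_finite setT lebesgue_rV_step.
Proof.
have /sigma_finiteP[F [TF ndF Foo]] := sigma_finiteT (@lebesgue_measure R).
have /sigma_finiteP[G [TG ndG Goo]] := sigma_finiteT m.
exists (fun k => @rV_uncons R n @^-1` (F k `*` G k)).
  rewrite -preimage_bigcup (_ : \bigcup_i _ = setT) ?preimage_setT//.
  apply/seteqP; split => // -[x y] _.
  have [k _ Fkx] : (\bigcup_i F i) x by rewrite -TF.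
  have [l _ Gly] : (\bigcup_i G i) y by rewrite -TG.
  exists (maxn k l) => //; split.
  - by move: x Fkx; exact/subsetPset/ndF/leq_maxl.
  - by move: y Gly; exact/subsetPset/ndG/leq_maxr.
move=> k; have [mFk Fkoo] := Foo k; have [mGk Gkoo] := Goo k; split.
  rewrite -[X in measurable X]setTI; apply: measurable_rV_uncons => //.
  exact: measurableX.
rewrite /lebesgue_rV_step /pushforward -comp_preimage.
rewrite (_ : _ \o _ = id) ?preimage_id; last first.
  by apply/funext => p; exact: rV_consK.
by rewrite product_measure1E// lte_mul_pinfty// ge0_fin_numE.
Qed.

HB.instance Definition _ := Measure_isSigmaFinite.Build _ _ _
  lebesgue_rV_step step_sigma_finite.

End lebesgue_rV_step.

Fixpoint lebesgue_rV (R : realType) (n : nat) :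
    {sigma_finite_measure set 'rV[R]_n -> \bar R} :=
  match n with
  | 0 => @dirac _ 'rV[R]_0 0 R
  | k.+1 => lebesgue_rV_step (lebesgue_rV R k)
  end.

Definition box (R : realType) (d : nat) (a L : 'rV[R]_d) : set 'rV[R]_d :=
  [set x | forall i, a ord0 i <= x ord0 i <= a ord0 i + L ord0 i].

Lemma measurable_box (R : realType) (d : nat) (a L : 'rV[R]_d) :
  measurable (box a L).
Proof.
rewrite (_ : box a L = \bigcap_(i in [set: 'I_d])
    (@rV_coord R d i @^-1` `[a ord0 i, a ord0 i + L ord0 i]%classic)).
  apply: fin_bigcap_measurable => // i _; rewrite -[X in measurable X]setTI.
  exact: (@measurable_rV_coord R d i).
apply/seteqP; split => x /= xB i; first by move=> _; rewrite /= in_itv/=.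
by have := xB i Logic.I; rewrite /= in_itv.
Qed.

Definition box_measure (R : realType) (d : nat) (a L : 'rV[R]_d) :
    {measure set 'rV[R]_d -> \bar R} :=
  mrestr (lebesgue_rV R d) (measurable_box a L).

Definition dot (R : realType) (d : nat) (p q : 'rV[R]_d) : R :=
  \sum_(i < d) p ord0 i * q ord0 i.

(* [`|p|] is the sup norm of ['rV[R]_d]; the scheme needs the Euclidean one. *)
Definition enorm (R : realType) (d : nat) (p : 'rV[R]_d) : R :=
  Num.sqrt (dot p p).

Definition ip (R : realType) (d : nat) (a L : 'rV[R]_d)
    (f g : 'rV[R]_d -> R) : R :=
  \int[box_measure a L]_x (f x * g x).

Definition ipv (R : realType) (d : nat) (a L : 'rV[R]_d)
    (F G : 'rV[R]_d -> 'rV[R]_d) : R :=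
  \int[box_measure a L]_x dot (F x) (G x).

Definition L2norm (R : realType) (d : nat) (a L : 'rV[R]_d)
    (f : 'rV[R]_d -> R) : R := Num.sqrt (ip a L f f).

Definition L2normv (R : realType) (d : nat) (a L : 'rV[R]_d)
    (F : 'rV[R]_d -> 'rV[R]_d) : R := Num.sqrt (ipv a L F F).

Definition basis_vec (R : realType) (d : nat) (i : 'I_d) : 'rV[R]_d :=
  delta_mx ord0 i.

Definition periodic (R : realType) (d : nat) (L : 'rV[R]_d) (T : Type)
    (f : 'rV[R]_d -> T) : Prop :=
  forall x i, f (x + L ord0 i *: basis_vec R i) = f x.

Definition L2per (R : realType) (d : nat) (a L : 'rV[R]_d)
    (f : 'rV[R]_d -> R) : Prop :=
  periodic L f /\ f \in Lfun (box_measure a L) 2%:E.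

(* C^oo: every iterated partial derivative exists and is continuous. *)
Definition smooth (R : realType) (d : nat) (f : 'rV[R]_d -> R) : Prop :=
  forall s : seq 'I_d,
    let g := foldr (fun i h => 'D_(basis_vec R i) h) f s in
    continuous g /\ forall x i, derivable g x (basis_vec R i).

Definition weak_gradient (R : realType) (d : nat) (a L : 'rV[R]_d)
    (u : 'rV[R]_d -> R) (Du : 'rV[R]_d -> 'rV[R]_d) : Prop :=
  forall (psi : 'rV[R]_d -> R) (i : 'I_d), smooth psi -> periodic L psi ->
    ip a L u ('D_(basis_vec R i) psi) = - ip a L (fun x => Du x ord0 i) psi.

(* [H1per a L u Du]: [u] belongs to H^1_per and [Du] represents its gradient,
   which is determined by [u] almost everywhere. *)
Definition H1per (R : realType) (d : nat) (a L : 'rV[R]_d)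
    (u : 'rV[R]_d -> R) (Du : 'rV[R]_d -> 'rV[R]_d) : Prop :=
  [/\ L2per a L u,
      forall i, L2per a L (fun x => Du x ord0 i) &
      weak_gradient a L u Du].

Definition Zdir (R : realType) (d : nat) (p : 'rV[R]_d) : 'rV[R]_d :=
  if p == 0 then 0 else (enorm p)^-1 *: p.

Definition Gpot (R : realType) (he r : R) : R :=
  if 1 - he <= r then
    r * ln r + (1 - r) ^+ 2 / (2 * he) + (1 - r) * ln he - he / 2
  else if he <= r then
    r * ln r + (1 - r) * ln (1 - r)
  else
    (1 - r) * ln (1 - r) + r ^+ 2 / (2 * he) + r * ln he - he / 2.

Definition Hfun (R : realType) (he B r : R) : R :=
  derive1 (Gpot he) r / Num.sqrt (Gpot he r + B).

Definition energy (R : realType) (d : nat) (a L : 'rV[R]_d)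
    (eps alpha beta B : R) (Dphi : 'rV[R]_d -> 'rV[R]_d)
    (U V W : 'rV[R]_d -> R) : R :=
  eps / 2 * L2normv a L Dphi ^+ 2 + (4 * eps)^-1 * L2norm a L U ^+ 2
  + alpha / 2 * L2norm a L V ^+ 2 + beta * L2norm a L W ^+ 2 - beta * B.

(* Main.v *)
Require Import Defs.
From HB Require Import structures.
From mathcomp Require Import all_boot all_order all_algebra.
From mathcomp Require Import all_classical all_reals all_analysis.
From mathcomp Require Import measurable_realfun ring lra.

Set Implicit Arguments.
Unset Strict Implicit.
Unset Printing Implicit Defensive.

Import Order.TTheory GRing.Theory Num.Theory.
Import numFieldNormedType.Exports.

Local Open Scope classical_set_scope.
Local Open Scope ring_scope.

(** The law is an exact energy balance from which nonnegative squares are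
dropped.  Test the [phi] equation with [muphi1], the [muphi1] equation with
[phi1 - phi0], the [rho] equation with [murho1], and multiply the pointwise
formula for [murho1] by [rho1 - rho0].  The updates of the auxiliary variables
are designed so that each nonlinear product then becomes a product of an
auxiliary variable with its own increment:
- [phi0 U1 (phi1 - phi0) = U1 (U1 - U0) / 2],
- [V1 Z . D(phi1 - phi0) = V1 (rho1 - rho0) - V1 (V1 - V0)],
- [H W1 (rho1 - rho0) = 2 W1 (W1 - W0)].

The term [alpha (V1, rho1 - rho0)] enters the two balances with opposite signs,
so adding them leaves
[eps (Dphi1, Dphi1 - Dphi0) + (2 eps)^-1 (U1, U1 - U0) + alpha (V1, V1 - V0)
+ 2 beta (W1, W1 - W0)] equal to
[- dt (M1 |Dmuphi1|^2 + M2 |Dmurho1|^2)].  The lower bound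
[2 (f, f - g) >= |f|^2 - |g|^2] ([L2norm_sub_le], [L2normv_sub_le]), applied to
each of the four pairings, shows that this is at least the energy increment.

What remains is measure theory.  The test function [phi1 - phi0] must belong
to H^1_per ([H1perB]).  The factors of [phi0 U1 (phi1 - phi0)] are only known
to be L2, so the increment has to be tested as a whole: testing with [phi1] and
[phi0] one after the other could meet divergent integrals.  Linearity of the
weak gradient requires the pairing of an L2 function with a derivative of a
smooth function to be integrable, which holds because a continuous function is
Borel measurable ([continuous_measurable_rV]) and bounded on the box, whose
measure is finite ([lebesgue_rV_box_lty]). *)

(** * Borel sets, continuous functions and boxes *)

Section Borel.
Variables (R : realType) (n : nat).

Lemma measurable_rV_ball (x : 'rV[R]_n) (e : R) : measurable (ball x e).
Proof.
have [e0|e0] := ltP 0 e; last first.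
  rewrite (_ : ball x e = set0) //; apply/seteqP; split => // y [e_gt0 _].
  by move: (lt_le_trans e_gt0 e0); rewrite ltxx.
rewrite (_ : ball x e = \bigcap_(i in [set: 'I_n])
    (@rV_coord R n i @^-1` (ball (x ord0 i) e))).
  apply: fin_bigcap_measurable => // i _; rewrite -[X in measurable X]setTI.
  by apply: measurable_rV_coord => //; exact: open_measurable (ball_open _ _).
apply/seteqP; split => y /=; first by case=> _ xy i _; exact: xy.
by move=> xy; split=> // i j; rewrite ord1; exact: xy.
Qed.

(** The sigma-algebra on row vectors is generated by the coordinates, so balls
for the sup norm are measurable; an open set is a countable union of balls with
rational centres and radii [k.+1^-1]. *)
Lemma open_measurable_rV (U : set 'rV[R]_n) : open U -> measurable U.
Proof.
move=> oU.
pose V (p : 'rV[rat]_n * nat) : set 'rV[R]_n :=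
  ball (map_mx ratr p.1 : 'rV[R]_n) p.2.+1%:R^-1.
rewrite (_ : U = \bigcup_p (if `[< V p `<=` U >] then V p else set0)).
  apply: countable_bigcupT_measurable => // p.
  by case: ifP => // _; exact: measurable_rV_ball.
apply/seteqP; split => [x Ux|x [p _]]; last first.
  by case: asboolP => // + Vx; apply.
have /nbhs_ballP[e /= e0 xeU] : nbhs x U by exact: open_nbhs_nbhs.
(* Half of [e], because [V] has its centre off [x]: two radii are needed to go
   from [x] to a point of [V]. *)
have [k] := ltr_add_invr (divr_gt0 e0 (ltr0n R 2)).
rewrite add0r; set r := _^-1 => re.
have r0 : 0 < r by rewrite invr_gt0.
have /choice[q xq] (i : 'I_n) : exists q : rat, ball (x ord0 i) r (ratr q : R).
  have [|q] := @rat_in_itvoo R (x ord0 i - r) (x ord0 i + r); first by lra.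
  by rewrite in_itv/= => qx; exists q; rewrite /ball/= ltr_distlC.
have xV : ball x r (map_mx ratr (\row_i q i) : 'rV[R]_n).
  by split=> // i j; rewrite !mxE ord1; exact: xq.
exists (\row_i q i, k) => //; rewrite asboolT; first exact/ball_sym.
move=> y Vy; apply: xeU.
by apply: le_ball (ball_triangle xV Vy); rewrite /= -/r; lra.
Qed.

Lemma continuous_measurable_rV (f : 'rV[R]_n -> R) :
  continuous f -> measurable_fun setT f.
Proof.
move=> /continuousP cf; apply: (measurability _ (RGenOpens.measurableE R)).
move=> _ [_ [a [b ->] <-]]; rewrite setTI; apply: open_measurable_rV.
exact/cf/interval_open.
Qed.

Lemma compact_box (a L : 'rV[R]_n) : compact (box a L).
Proof.
rewrite (_ : box a L = [set v : 'rV[R]_n | forall i,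
    `[a ord0 i, a ord0 i + L ord0 i]%classic (v ord0 i)]).
  apply: (@rV_compact R n
    (fun i => `[a ord0 i, a ord0 i + L ord0 i]%classic)) => i.
  exact: segment_compact.
by apply/seteqP; split => x /= + i => /(_ i); rewrite in_itv.
Qed.

Lemma continuous_bounded_box (a L : 'rV[R]_n) (f : 'rV[R]_n -> R) :
  continuous f -> exists M, forall x, box a L x -> `|f x| <= M.
Proof.
move=> cf; have /compact_bounded[M [_ fM]] : compact (f @` box a L).
  apply: continuous_compact; last exact: compact_box.
  exact: continuous_subspaceT.
exists (M + 1) => x xB; apply: (fM (M + 1)); first by rewrite ltrDl.
by exists x.
Qed.

End Borel.

(** Under [rV_cons] a box is the product of its first side with a box of one
dimension less. *)
Lemma lebesgue_rV_box_lty (R : realType) (n : nat) (a L : 'rV[R]_n) :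
  (lebesgue_rV R n (box a L) < +oo)%E.
Proof.
elim: n a L => [|n IH] a L /=.
  by rewrite diracE ltry.
rewrite /lebesgue_rV_step /= /pushforward.
pose t (v : 'rV[R]_n.+1) : 'rV[R]_n := \row_j v ord0 (lift ord0 j).
rewrite (_ : _ @^-1` _ = `[a ord0 ord0, a ord0 ord0 + L ord0 ord0]%classic
    `*` box (t a) (t L)).
  rewrite product_measure1E//; last exact: measurable_box.
  apply: lte_mul_pinfty => //.
  rewrite ge0_fin_numE //.
  by rewrite /= lebesgue_measure_itv/=; case: ifP => _; rewrite ltry.
apply/seteqP; split => -[x v] /=.
  move=> xB; split=> [|i].
    by have := xB ord0; rewrite rV_consE unlift_none in_itv.
  by have := xB (lift ord0 i); rewrite rV_consE liftK /t !mxE.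
rewrite in_itv /= => -[x0 vB] i; rewrite rV_consE.
by case: unliftP => [j ->|->] //; have := vB j; rewrite !mxE.
Qed.

(** * The L2 pairing on the box *)

Section L2.
Variables (R : realType) (d : nat) (a L : 'rV[R]_d).
Let mu := box_measure a L.
Implicit Types f g h : 'rV[R]_d -> R.

Local Notation L2 := (Lfun mu 2%:E).

Lemma box_measure_fin_num : mu setT \is a fin_num.
Proof.
rewrite ge0_fin_numE //.
have -> : mu setT = lebesgue_rV R d (box a L).
  by rewrite -[in RHS](setTI (box a L)).
exact: lebesgue_rV_box_lty.
Qed.

Lemma ae_box : \forall x \ae mu, box a L x.
Proof.
exists (~` box a L); split => //.
  by apply: measurableC; exact: measurable_box.
have -> : mu (~` box a L) = lebesgue_rV R d set0 by rewrite -(setICl (box a L)).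
exact: measure0.
Qed.

Lemma L2_measurable f : f \in L2 -> measurable_fun setT f.
Proof. by rewrite inE => /andP[]; rewrite inE. Qed.

Lemma L2B f g : f \in L2 -> g \in L2 -> (fun x => f x - g x) \in L2.
Proof.
by move=> f2 g2; rewrite -[X in X \in _]/(f - g) rpredB ?lee1n.
Qed.

Lemma L2_integrable f g : f \in L2 -> g \in L2 ->
  mu.-integrable setT (EFin \o (fun x => f x * g x)).
Proof. by move=> f2 g2; apply/Lfun1_integrable/Lfun2_mul_Lfun1. Qed.

Lemma ae_eq_Rintegral f g : measurable_fun setT f -> measurable_fun setT g ->
  {ae mu, f =1 g} -> \int[mu]_x f x = \int[mu]_x g x.
Proof.
move=> mf mg fg; congr fine; apply: ae_eq_integral => //.
- exact/measurable_EFinP.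
- exact/measurable_EFinP.
- by apply: filterS fg => x -> _.
Qed.

Lemma ipC f g : ip a L f g = ip a L g f.
Proof. by apply: eq_Rintegral => x _; rewrite mulrC. Qed.

Lemma ipBr f g h : f \in L2 -> g \in L2 -> h \in L2 ->
  ip a L f (fun x => g x - h x) = ip a L f g - ip a L f h.
Proof.
move=> f2 g2 h2; rewrite /ip -RintegralB //; try exact: L2_integrable.
by apply: eq_Rintegral => x _; rewrite mulrBr.
Qed.

Lemma ipBl f g h : f \in L2 -> g \in L2 -> h \in L2 ->
  ip a L (fun x => g x - h x) f = ip a L g f - ip a L h f.
Proof. by move=> f2 g2 h2; rewrite ipC ipBr// ipC (ipC f h). Qed.

Lemma ip_divl c f g : f \in L2 -> g \in L2 ->
  ip a L (fun x => f x / c) g = ip a L f g / c.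
Proof.
move=> f2 g2; rewrite /ip -RintegralZr//; last exact: L2_integrable.
by apply: eq_Rintegral => x _; rewrite mulrAC.
Qed.

Lemma L2normE f : L2norm a L f ^+ 2 = ip a L f f.
Proof.
by rewrite sqr_sqrtr//; apply: Rintegral_ge0 => x _; rewrite -expr2 sqr_ge0.
Qed.

(** Expand [0 <= |f - g|^2]. *)
Lemma L2norm_sub_le f g : f \in L2 -> g \in L2 ->
  L2norm a L f ^+ 2 - L2norm a L g ^+ 2 <= 2 * ip a L f (fun x => f x - g x).
Proof.
move=> f2 g2; rewrite !L2normE ipBr//.
have := sqr_ge0 (L2norm a L (fun x => f x - g x)).
rewrite L2normE ipBr ?L2B// !ipBl// (ipC g f); lra.
Qed.

Section fields.
Variables F G : 'rV[R]_d -> 'rV[R]_d.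
Hypotheses (F2 : forall i, (fun x => F x ord0 i) \in L2)
           (G2 : forall i, (fun x => G x ord0 i) \in L2).

Lemma ipvE : ipv a L F G =
  \sum_(i < d) ip a L (fun x => F x ord0 i) (fun x => G x ord0 i).
Proof.
rewrite /ipv /Rintegral /dot.
under eq_integral do rewrite -sumEFin.
rewrite integral_sum//; last by move=> i; exact: L2_integrable.
rewrite -sum_fine// => i _; apply: integrable_fin_num => //.
exact: L2_integrable.
Qed.

End fields.

Lemma L2normvE (F : 'rV[R]_d -> 'rV[R]_d) : L2normv a L F ^+ 2 = ipv a L F F.
Proof.
rewrite sqr_sqrtr//; apply: Rintegral_ge0 => x _.
by apply: sumr_ge0 => i _; rewrite -expr2 sqr_ge0.
Qed.

Lemma L2normv_sub_le (F G : 'rV[R]_d -> 'rV[R]_d) :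
  (forall i, (fun x => F x ord0 i) \in L2) ->
  (forall i, (fun x => G x ord0 i) \in L2) ->
  L2normv a L F ^+ 2 - L2normv a L G ^+ 2
  <= 2 * ipv a L F (fun x => F x - G x).
Proof.
move=> F2 G2; rewrite !L2normvE !ipvE//; last first.
  move=> i; rewrite (_ : (fun _ => _) = fun x => F x ord0 i - G x ord0 i).
    exact: L2B.
  by apply/funext => x; rewrite !mxE.
rewrite -sumrB mulr_sumr; apply: ler_sum => i _.
rewrite (_ : (fun x => (F x - G x) ord0 i) = fun x => F x ord0 i - G x ord0 i).
  by have := L2norm_sub_le (F2 i) (G2 i); rewrite !L2normE.
by apply/funext => x; rewrite !mxE.
Qed.

(** The function [h] may be unbounded on the whole space, where [box_measure]
formally lives; cutting it off outside the box changes no integral and makes it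
bounded everywhere, hence integrable against L2 functions. *)
Lemma ip_smooth_sub f g h : f \in L2 -> g \in L2 -> continuous h ->
  ip a L (fun x => f x - g x) h = ip a L f h - ip a L g h.
Proof.
move=> f2 g2 ch.
have mh : measurable_fun setT h by exact: continuous_measurable_rV.
have mB : measurable_fun setT (\1_(box a L) : 'rV[R]_d -> R).
  by apply: measurable_indic; exact: measurable_box.
pose k x := h x * \1_(box a L) x.
have mk : measurable_fun setT k by exact: measurable_funM.
have hk u : u \in L2 -> ip a L u h = ip a L u k.
  move=> /L2_measurable m_u; apply: ae_eq_Rintegral.
  - exact: measurable_funM.
  - exact: measurable_funM.
  - by apply: filterS ae_box => x xB; rewrite /k indicE mem_set// mulr1.
have k_int u : u \in L2 -> mu.-integrable setT (EFin \o (fun x => u x * k x)).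
  move=> /(Lfun_subset12 box_measure_fin_num)/Lfun1_integrable u1.
  rewrite (_ : _ \o _ = ((EFin \o u) \* (EFin \o k))%E) //.
  apply: integrableMl => //.
  have [M hM] := continuous_bounded_box a L ch.
  exists (Num.max 0 M); split; first exact: num_real.
  move=> c Mc x _ /=; rewrite (le_trans _ (ltW Mc))// /k indicE.
  have [/set_mem xB|_] := boolP (x \in box a L).
    by rewrite mulr1 le_max hM ?orbT.
  by rewrite mulr0 normr0 le_max lexx.
rewrite !hk ?L2B// /ip -RintegralB //; try exact: k_int.
by apply: eq_Rintegral => x _; rewrite mulrBl.
Qed.

(** * Periodic function spaces *)

Lemma L2perB f g : L2per a L f -> L2per a L g ->
  L2per a L (fun x => f x - g x).
Proof.
move=> [pf f2] [pg g2]; split; last exact: L2B.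
by move=> x i; rewrite pf pg.
Qed.

Lemma H1perB f g F G : H1per a L f F -> H1per a L g G ->
  H1per a L (fun x => f x - g x) (fun x => F x - G x).
Proof.
move=> [f2 F2 fF] [g2 G2 gG].
have FGE i : (fun x => (F x - G x) ord0 i)
    = (fun x => F x ord0 i - G x ord0 i) by apply/funext => x; rewrite !mxE.
split; first exact: L2perB.
  by move=> i; rewrite FGE; exact: L2perB.
move=> psi i spsi ppsi.
(* [smooth] at the empty list is continuity of [psi], at [[:: i]] that of its
   [i]-th partial derivative. *)
have [cpsi _] := spsi [::]; have [cDpsi _] := spsi [:: i].
have [_ Lf] := f2; have [_ Lg] := g2.
have [_ LF] := F2 i; have [_ LG] := G2 i.
by rewrite FGE !ip_smooth_sub// fF// gG// opprD.
Qed.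

End L2.

(** * The direction field *)

Section Zdir.
Variables (R : realType) (d : nat).

(** A negative power of zero is zero, so one formula covers both branches of
[Zdir]; measurability of [Zdir] then follows from that of real powers. *)
Lemma ZdirE (p : 'rV[R]_d) : Zdir p = (dot p p) `^ (- 2^-1) *: p.
Proof.
rewrite /Zdir; case: eqP => [->|_]; first by rewrite scaler0.
rewrite powRN powR12_sqrt//.
by apply: sumr_ge0 => i _; rewrite -expr2 sqr_ge0.
Qed.

Lemma measurable_dot (F G : 'rV[R]_d -> 'rV[R]_d) :
  (forall i, measurable_fun setT (fun x => F x ord0 i : R)) ->
  (forall i, measurable_fun setT (fun x => G x ord0 i : R)) ->
  measurable_fun setT (fun x => dot (F x) (G x)).
Proof.
move=> mF mG; apply: measurable_sum => i.
exact: measurable_funM.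
Qed.

Lemma measurable_Zdir (F : 'rV[R]_d -> 'rV[R]_d) :
  (forall i, measurable_fun setT (fun x => F x ord0 i : R)) ->
  forall i, measurable_fun setT (fun x => Zdir (F x) ord0 i : R).
Proof.
move=> mF i.
rewrite (_ : (fun _ => _) = fun x => (dot (F x) (F x)) `^ (- 2^-1) * F x ord0 i).
  apply: measurable_funM => //.
  apply: (measurableT_comp (measurable_powR _)).
  exact: measurable_dot.
by apply/funext => x; rewrite ZdirE mxE.
Qed.

Lemma dotZl c (p q : 'rV[R]_d) : dot (c *: p) q = c * dot p q.
Proof. by rewrite /dot mulr_sumr; apply: eq_bigr => i _; rewrite mxE mulrA. Qed.

End Zdir.

(** * Energy dissipation *)

Theorem theorem3p2 (R : realType) (d : nat) (hd : d = 2%N \/ d = 3%N)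
  (a L : 'rV[R]_d) (hL : forall i, 0 < L ord0 i)
  (eps alpha beta M1 M2 : R)
  (heps : 0 < eps) (halpha : 0 < alpha) (hbeta : 0 < beta)
  (hM1 : 0 < M1) (hM2 : 0 < M2)
  (he B : R) (hhe : 0 < he < 1 / 2)
  (hB : 0 < B) (hGB : forall r : R, 0 < Gpot he r + B)
  (dt : R) (hdt : 0 < dt)
  (phi0 rho0 U0 V0 W0 : 'rV[R]_d -> R) (Dphi0 : 'rV[R]_d -> 'rV[R]_d)
  (phi1 muphi1 rho1 murho1 U1 V1 W1 : 'rV[R]_d -> R)
  (Dphi1 Dmuphi1 Dmurho1 : 'rV[R]_d -> 'rV[R]_d)
  (hphi0 : H1per a L phi0 Dphi0) (hrho0 : L2per a L rho0)
  (hU0 : L2per a L U0) (hV0 : L2per a L V0) (hW0 : L2per a L W0)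
  (hphi1 : H1per a L phi1 Dphi1) (hmuphi1 : H1per a L muphi1 Dmuphi1)
  (hrho1 : L2per a L rho1) (hmurho1 : H1per a L murho1 Dmurho1)
  (hU1 : L2per a L U1) (hV1 : L2per a L V1) (hW1 : L2per a L W1)
  (eq_phi : forall psi Dpsi, H1per a L psi Dpsi ->
     ip a L (fun x => (phi1 x - phi0 x) / dt) psi
     = - (M1 * ipv a L Dmuphi1 Dpsi))
  (eq_muphi : forall psi Dpsi, H1per a L psi Dpsi ->
     ip a L muphi1 psi
     = eps * ipv a L Dphi1 Dpsi
       + eps^-1 * ip a L (fun x => phi0 x * U1 x) psi
       - alpha * ipv a L (fun x => V1 x *: Zdir (Dphi0 x)) Dpsi)
  (eq_rho : forall psi Dpsi, H1per a L psi Dpsi ->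
     ip a L (fun x => (rho1 x - rho0 x) / dt) psi
     = - (M2 * ipv a L Dmurho1 Dpsi))
  (eq_murho : \forall x \ae box_measure a L,
     murho1 x = alpha * V1 x + beta * Hfun he B (rho0 x) * W1 x)
  (eq_U : \forall x \ae box_measure a L,
     U1 x - U0 x = 2 * phi0 x * (phi1 x - phi0 x))
  (eq_V : \forall x \ae box_measure a L,
     V1 x - V0 x = (rho1 x - rho0 x)
                   - dot (Zdir (Dphi0 x)) (Dphi1 x - Dphi0 x))
  (eq_W : \forall x \ae box_measure a L,
     W1 x - W0 x = 1 / 2 * Hfun he B (rho0 x) * (rho1 x - rho0 x)) :
  1 / dt * (energy a L eps alpha beta B Dphi1 U1 V1 W1
            - energy a L eps alpha beta B Dphi0 U0 V0 W0)
  <= - M1 * L2normv a L Dmuphi1 ^+ 2 - M2 * L2normv a L Dmurho1 ^+ 2.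
Proof.
pose mu := box_measure a L.
have [_ U0_2] := hU0; have [_ V0_2] := hV0; have [_ W0_2] := hW0.
have [_ U1_2] := hU1; have [_ V1_2] := hV1; have [_ W1_2] := hW1.
have [_ rho0_2] := hrho0; have [_ rho1_2] := hrho1.
have [[_ phi0_2] Dphi0_2 _] := hphi0; have [[_ phi1_2] Dphi1_2 _] := hphi1.
have [[_ muphi1_2] _ _] := hmuphi1; have [[_ murho1_2] _ _] := hmurho1.
have mphi0 := L2_measurable phi0_2; have mmurho1 := L2_measurable murho1_2.
have mU1 := L2_measurable U1_2; have mV1 := L2_measurable V1_2.
pose psi x := phi1 x - phi0 x; pose Dpsi x := Dphi1 x - Dphi0 x.
pose r x := rho1 x - rho0 x.
have psi_2 : psi \in Lfun mu 2%:E by exact: L2B.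
have r_2 : r \in Lfun mu 2%:E by exact: L2B.
have mpsi := L2_measurable psi_2; have mr := L2_measurable r_2.
have dU_2 := L2B U1_2 U0_2; have dV_2 := L2B V1_2 V0_2.
have dW_2 := L2B W1_2 W0_2.
have balance_phi := eq_phi _ _ hmuphi1.
rewrite (ip_divl _ psi_2 muphi1_2) in balance_phi.
have balance_rho := eq_rho _ _ hmurho1.
rewrite (ip_divl _ r_2 murho1_2) in balance_rho.
have chem_phi := eq_muphi _ _ (H1perB hphi1 hphi0).
rewrite -/psi -/Dpsi ipC in chem_phi.
(* [2 phi0 (phi1 - phi0)] is the increment of [U]. *)
have double_well : ip a L (fun x => phi0 x * U1 x) psi
    = 2^-1 * ip a L U1 (fun x => U1 x - U0 x).
  rewrite {2}/ip -RintegralZl//; last exact: L2_integrable.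
  apply: ae_eq_Rintegral.
  - by apply: measurable_funM => //; apply: measurable_funM.
  - apply: measurable_funM => //; apply: measurable_funM => //.
    exact: L2_measurable dU_2.
  - by apply: filterS eq_U => x ->; rewrite /psi; field.
(* [Z . D(phi1 - phi0)] is the increment of [rho] minus that of [V]. *)
have coupling : ipv a L (fun x => V1 x *: Zdir (Dphi0 x)) Dpsi
    = ip a L V1 r - ip a L V1 (fun x => V1 x - V0 x).
  rewrite -ipBr//; apply: ae_eq_Rintegral.
  - rewrite (_ : (fun _ => _) = fun x => V1 x * dot (Zdir (Dphi0 x)) (Dpsi x)).
      apply: measurable_funM => //; apply: measurable_dot => i.
        by apply: measurable_Zdir => j; case: (Dphi0_2 j) => _ /L2_measurable.
      rewrite (_ : (fun _ => _) = fun x => Dphi1 x ord0 i - Dphi0 x ord0 i).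
        apply: measurable_funB.
          by case: (Dphi1_2 i) => _ /L2_measurable.
        by case: (Dphi0_2 i) => _ /L2_measurable.
      by apply/funext => x; rewrite !mxE.
    by apply/funext => x; rewrite dotZl.
  - apply: measurable_funM => //; apply: measurable_funB => //.
    exact: L2_measurable dV_2.
  - by apply: filterS eq_V => x ->; rewrite dotZl /r /Dpsi; ring.
(* [H (rho1 - rho0)] is twice the increment of [W]. *)
have chem_rho : ip a L r murho1
    = alpha * ip a L V1 r + 2 * beta * ip a L W1 (fun x => W1 x - W0 x).
  rewrite {2 3}/ip -!RintegralZl//; try exact: L2_integrable.
  have iV : mu.-integrable setT (EFin \o (fun x => alpha * (V1 x * r x))).
    exact: integrableZl measurableT alpha _ (L2_integrable V1_2 r_2).
  have iW : mu.-integrable setT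
      (EFin \o (fun x => 2 * beta * (W1 x * (W1 x - W0 x)))).
    exact: integrableZl measurableT (2 * beta) _ (L2_integrable W1_2 dW_2).
  rewrite -RintegralD//; apply: ae_eq_Rintegral.
  - exact: measurable_funM.
  - apply: measurable_funD.
      by apply: measurable_funM => //; exact: measurable_funM.
    apply: measurable_funM => //; apply: measurable_funM.
      exact: L2_measurable W1_2.
    exact: L2_measurable dW_2.
  - by apply: filterS2 eq_murho eq_W => x -> ->; rewrite /r; field.
have hU := L2norm_sub_le U1_2 U0_2.
have hV := L2norm_sub_le V1_2 V0_2.
have hW := L2norm_sub_le W1_2 W0_2.
have hD : L2normv a L Dphi1 ^+ 2 - L2normv a L Dphi0 ^+ 2
    <= 2 * ipv a L Dphi1 Dpsi.
  by apply: L2normv_sub_le => i; [case: (Dphi1_2 i)|case: (Dphi0_2 i)].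
(* By the balances, the right-hand side is the sum of the two tested chemical
   potentials divided by [dt]. *)
rewrite !L2normvE -/mu in balance_phi balance_rho *.
rewrite mulNr -balance_phi.
rewrite -[X in _ - X]opprK -balance_rho opprK -mulrDl div1r mulrC.
rewrite ler_pM2r ?invr_gt0// chem_phi chem_rho double_well coupling /energy.
have := ler_wpM2l (ltW heps) hD.
have := ler_wpM2l (ltW halpha) hV.
have := ler_wpM2l (ltW hbeta) hW.
have : 0 <= eps^-1 by rewrite invr_ge0 ltW.
move=> /ler_wpM2l/(_ _ _ hU).
rewrite invfM !L2normvE.
lra.
Qed.
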